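(* Let $\mathsf{C}$ be a representable partializable Markov category, with distribution monad $(P,\mu,\delta)$. An algebra for the distribution monad on $\mathsf{Partial}(\mathsf{C})_{\mathrm{cop}}$ consists of an object $A$ together with a partial morphism $PA\to A$, represented by a span in $\mathsf{C}_{\det}$ $$PA\xleftarrow{\;d\;}D\xrightarrow{\;a\;}A$$ ($d$ a monomorphism of $\mathsf{C}$) such that, in $\mathsf{C}_{\det}$: (i) the unit $\delta_A\colon A\to PA$ factors (uniquely) through $d$ via a section of $a$, i.e. there is $s\colon A\to D$ with $d\circ s=\delta_A$ and $a\circ s=\mathrm{id}_A$; (ii) the multiplication $\mu\colon P^2A\to PA$ and $d\colon D\to PA$ have the same pullback $D'$ as $Pa\colon PD\to PA$ and $d\colon D\to PA$; that is, there are an object $D'$ and morphisms $t\colon D'\to PD$, $b\colon D'\to D$, $c\colon D'\to D$ such that $(D',t,b)$ is a pullback of $Pa$ and $d$ (so $Pa\circ t=d\circ b$) and $(D',Pd\circ t,c)$ is a pullback of $\mu$ and $d$ (so $\mu\circ Pd\circ t=d\circ c$); (iii) with these maps, $a\circ b=a\circ c$.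
   Context: A CD category is a symmetric monoidal category $(\mathsf{C},\otimes,I)$ in which every object $X$ carries a commutative comonoid structure $\mathrm{copy}_X\colon X\to X\otimes X$, $\mathrm{del}_X\colon X\to I$, compatible with tensor products ($\mathrm{copy}_{X\otimes Y}$ is $\mathrm{copy}_X\otimes\mathrm{copy}_Y$ followed by swapping the two middle factors, and $\mathrm{del}_{X\otimes Y}=\mathrm{del}_X\otimes\mathrm{del}_Y$) and with $\mathrm{copy}_I=\mathrm{del}_I=\mathrm{id}_I$; coherence isomorphisms are suppressed. A morphism $f\colon X\to Y$ is total if $\mathrm{del}_Y\circ f=\mathrm{del}_X$, copyable if $\mathrm{copy}_Y\circ f=(f\otimes f)\circ\mathrm{copy}_X$, and deterministic if it is both. $\mathsf{C}_{\mathrm{cop}}$ and $\mathsf{C}_{\det}$ are the wide subcategories of copyable and of deterministic morphisms. A Markov category is a CD category in which every morphism is total (so $\mathsf{C}_{\mathrm{cop}}=\mathsf{C}_{\det}$). A Markov category is positive if for all $u\colon X\to Y$, $v\colon Y\to Z$ with $v\circ u$ deterministic, $(u\otimes (v\circ u))\circ\mathrm{copy}_X=(\mathrm{id}_Y\otimes v)\circ\mathrm{copy}_Y\circ u$. A Markov category is representable if the inclusion $\mathsf{C}_{\det}\hookrightarrow\mathsf{C}$ has a right adjoint $P\colon\mathsf{C}\to\mathsf{C}_{\det}$; the unit is $\delta_X\colon X\to PX$, the counit is $\mathrm{samp}_X\colon PX\to X$, and the induced monad on $\mathsf{C}_{\det}$ is $(P,\mu,\delta)$ with $\mu_X=P(\mathrm{samp}_X)$.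 A Markov category $\mathsf{C}$ is partializable if: (i) it is positive; (ii) pullbacks of deterministic monomorphisms along arbitrary morphisms exist and are themselves deterministic (monomorphisms); (iii) if $i\colon D\to X$ is a deterministic monomorphism then $i\otimes\mathrm{id}_A$ is a monomorphism for every object $A$. For $\mathsf{C}$ partializable, the CD category $\mathsf{Partial}(\mathsf{C})$ has the objects of $\mathsf{C}$; its morphisms $X\to Y$ are equivalence classes of spans $X\xleftarrow{i}D\xrightarrow{f}Y$ (also written $(D,i,f)$) in $\mathsf{C}$ with $i$ a deterministic monomorphism, where $(D,i,f)\sim(D',i',f')$ iff there is an isomorphism $t\colon D\to D'$ with $i'\circ t=i$, $f'\circ t=f$. The composite of $(A,i,f)\colon X\to Y$ followed by $(B,j,g)\colon Y\to Z$ is $(C,i\circ u,g\circ v)$, where $A\xleftarrow{u}C\xrightarrow{v}B$ is the pullback of $f$ and $j$. The inclusion $\mathsf{C}\hookrightarrow\mathsf{Partial}(\mathsf{C})$ sends $f\colon X\to Y$ to $(X,\mathrm{id}_X,f)$. The tensor product is componentwise and the copy and delete maps are the images of those of $\mathsf{C}$. The morphisms of $\mathsf{Partial}(\mathsf{C})_{\mathrm{cop}}$ are exactly the classes of spans $(D,i,f)$ with $f$ deterministic. When $\mathsf{C}$ is representable, the distribution monad on $\mathsf{Partial}(\mathsf{C})_{\mathrm{cop}}$ is the monad acting as $P$ on objects, acting on morphisms by $P(D,d,f)=(PD,Pd,Pf)$, and with unit and multiplication the images of $\delta$ and $\mu$. An algebra for it (a partial algebra) is an Eilenberg–Moore algebra.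 *)

(* Defs.v *)
From Corelib Require Import ssreflect ssrfun.
From Stdlib Require Import ClassicalEpsilon FunctionalExtensionality
  PropExtensionality ProofIrrelevance.

Set Implicit Arguments.
Unset Strict Implicit.
Unset Printing Implicit Defensive.

Declare Scope cat_scope.
Open Scope cat_scope.

Record Category := {
  Ob :> Type;
  Hom : Ob -> Ob -> Type;
  idm : forall X, Hom X X;
  comp : forall X Y Z, Hom Y Z -> Hom X Y -> Hom X Z;
  comp_idl : forall X Y (f : Hom X Y), comp (idm Y) f = f;
  comp_idr : forall X Y (f : Hom X Y), comp f (idm X) = f;
  compA : forall X Y Z W (h : Hom Z W) (g : Hom Y Z) (f : Hom X Y),
    comp h (comp g f) = comp (comp h g) f
}.
Arguments Hom C X Y : clear implicits, rename.
Arguments idm {C} X : rename.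
Arguments comp {C X Y Z} g f : rename.
Arguments comp_idl {C X Y} f : rename.
Arguments comp_idr {C X Y} f : rename.
Arguments compA {C X Y Z W} h g f : rename.
Notation "g ∘ f" := (comp g f) (at level 40, left associativity) : cat_scope.

Definition mono (C : Category) (X Y : C) (i : Hom C X Y) : Prop :=
  forall (T : C) (g h : Hom C T X), i ∘ g = i ∘ h -> g = h.

Definition is_iso (C : Category) (X Y : C) (t : Hom C X Y) : Prop :=
  exists t' : Hom C Y X, t' ∘ t = idm X /\ t ∘ t' = idm Y.

(** [is_pullback f g p q]: the span [X <-p- W -q-> Y] is a pullback of the
    cospan [X -f-> Z <-g- Y]. *)
Definition is_pullback (C : Category) (X Y Z W : C)
    (f : Hom C X Z) (g : Hom C Y Z) (p : Hom C W X) (q : Hom C W Y) : Prop :=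
  f ∘ p = g ∘ q /\
  forall (T : C) (x : Hom C T X) (y : Hom C T Y), f ∘ x = g ∘ y ->
    exists! m : Hom C T W, p ∘ m = x /\ q ∘ m = y.

Record Functor (C D : Category) := {
  fobj :> C -> D;
  fmap : forall X Y, Hom C X Y -> Hom D (fobj X) (fobj Y);
  fmap_id : forall X, fmap (idm X) = idm (fobj X);
  fmap_comp : forall X Y Z (g : Hom C Y Z) (f : Hom C X Y),
    fmap (g ∘ f) = fmap g ∘ fmap f
}.
Arguments fmap {C D} F {X Y} f : rename.
Arguments fmap_id {C D} F X : rename.
Arguments fmap_comp {C D} F {X Y Z} g f : rename.

Definition id_functor (C : Category) : Functor C C :=
  @Build_Functor C C (fun X => X) (fun X Y f => f)
    (fun X => eq_refl) (fun X Y Z g f => eq_refl).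

Definition comp_functor (C D E : Category) (G : Functor D E) (F : Functor C D) :
  Functor C E.
Proof.
refine (@Build_Functor C E (fun X => G (F X)) (fun X Y f => fmap G (fmap F f)) _ _).
- by move=> X; rewrite !fmap_id.
- by move=> X Y Z g f; rewrite !fmap_comp.
Defined.

Record NatTrans (C D : Category) (F G : Functor C D) := {
  ntc :> forall X : C, Hom D (F X) (G X);
  nt_natural : forall (X Y : C) (f : Hom C X Y),
    ntc Y ∘ fmap F f = fmap G f ∘ ntc X
}.
Arguments nt_natural {C D F G} n {X Y} f : rename.

(** [F] is left adjoint to [G]. *)
Record Adjunction (C D : Category) (F : Functor C D) (G : Functor D C) := {
  adj_unit : NatTrans (id_functor C) (comp_functor G F);
  adj_counit : NatTrans (comp_functor F G) (id_functor D);
  adj_triangle_l : forall X : C,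
    adj_counit (F X) ∘ fmap F (adj_unit X) = idm (F X);
  adj_triangle_r : forall Y : D,
    fmap G (adj_counit Y) ∘ adj_unit (G Y) = idm (G Y)
}.

Record Monad (C : Category) := {
  mnd :> Functor C C;
  mnd_unit : NatTrans (id_functor C) mnd;
  mnd_mult : NatTrans (comp_functor mnd mnd) mnd;
  mnd_unit_l : forall X : C, mnd_mult X ∘ mnd_unit (mnd X) = idm (mnd X);
  mnd_unit_r : forall X : C, mnd_mult X ∘ fmap mnd (mnd_unit X) = idm (mnd X);
  mnd_assoc : forall X : C,
    mnd_mult X ∘ mnd_mult (mnd X) = mnd_mult X ∘ fmap mnd (mnd_mult X)
}.

Definition is_algebra (C : Category) (M : Monad C) (A : C) (alpha : Hom C (M A) A)
  : Prop :=
  alpha ∘ mnd_unit M A = idm A /\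
  alpha ∘ fmap M alpha = alpha ∘ mnd_mult M A.

Definition adj_mult (C D : Category) (F : Functor C D) (G : Functor D C)
  (adj : Adjunction F G) :
  NatTrans (comp_functor (comp_functor G F) (comp_functor G F)) (comp_functor G F).
Proof.
refine (@Build_NatTrans C C (comp_functor (comp_functor G F) (comp_functor G F))
  (comp_functor G F) (fun X => fmap G (adj_counit adj (F X))) _).
move=> X Y f /=; rewrite -!fmap_comp.
by have /= -> := nt_natural (adj_counit adj) (fmap F f).
Defined.

Definition adj_monad (C D : Category) (F : Functor C D) (G : Functor D C)
  (adj : Adjunction F G) : Monad C.
Proof.
refine (@Build_Monad C (comp_functor G F) (adj_unit adj) (adj_mult adj) _ _ _).
- by move=> X; exact: (adj_triangle_r adj (F X)).
- move=> X /=; rewrite -fmap_comp.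
  by have /= -> := adj_triangle_l adj X; rewrite fmap_id.
- move=> X /=; rewrite -!fmap_comp.
  by have /= -> := nt_natural (adj_counit adj) (adj_counit adj (F X)).
Defined.

Record MorClass (C : Category) := {
  mc_pred :> forall X Y : C, Hom C X Y -> Prop;
  mc_id : forall X : C, mc_pred (idm X);
  mc_comp : forall (X Y Z : C) (g : Hom C Y Z) (f : Hom C X Y),
    mc_pred g -> mc_pred f -> mc_pred (g ∘ f)
}.

Lemma sub_eq (T : Type) (Q : T -> Prop) (x y : {z | Q z}) :
  proj1_sig x = proj1_sig y -> x = y.
Proof.
case: x => x qx; case: y => y qy /= e.
by case: _ / e qy => qy; rewrite (proof_irrelevance _ qx qy).
Qed.

Definition WideSub (C : Category) (W : MorClass C) : Category.
Proof.
refine (@Build_Category (Ob C) (fun X Y => {f : Hom C X Y | W X Y f})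
  (fun X => exist _ (idm X) (mc_id W X))
  (fun X Y Z g f => exist _ (proj1_sig g ∘ proj1_sig f)
     (mc_comp (proj2_sig g) (proj2_sig f))) _ _ _).
- by move=> X Y f; apply: sub_eq; apply: comp_idl.
- by move=> X Y f; apply: sub_eq; apply: comp_idr.
- by move=> *; apply: sub_eq; apply: compA.
Defined.

Definition wide_incl (C : Category) (W : MorClass C) : Functor (WideSub W) C :=
  @Build_Functor (WideSub W) C (fun X => X) (fun X Y f => proj1_sig f)
    (fun X => eq_refl) (fun X Y Z g f => eq_refl).

Record SymMonCat := {
  smc_cat :> Category;
  tunit : smc_cat;
  tens : smc_cat -> smc_cat -> smc_cat;
  tensm : forall X X' Y Y', Hom smc_cat X X' -> Hom smc_cat Y Y' ->
    Hom smc_cat (tens X Y) (tens X' Y');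
  tens_id : forall X Y, tensm (idm X) (idm Y) = idm (tens X Y);
  tens_comp : forall X X' X'' Y Y' Y''
      (f' : Hom smc_cat X' X'') (f : Hom smc_cat X X')
      (g' : Hom smc_cat Y' Y'') (g : Hom smc_cat Y Y'),
    tensm (f' ∘ f) (g' ∘ g) = tensm f' g' ∘ tensm f g;
  assoc : forall X Y Z, Hom smc_cat (tens (tens X Y) Z) (tens X (tens Y Z));
  associ : forall X Y Z, Hom smc_cat (tens X (tens Y Z)) (tens (tens X Y) Z);
  assocK : forall X Y Z, associ X Y Z ∘ assoc X Y Z = idm _;
  associK : forall X Y Z, assoc X Y Z ∘ associ X Y Z = idm _;
  assoc_nat : forall X X' Y Y' Z Z' (f : Hom smc_cat X X')
      (g : Hom smc_cat Y Y') (h : Hom smc_cat Z Z'),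
    assoc X' Y' Z' ∘ tensm (tensm f g) h = tensm f (tensm g h) ∘ assoc X Y Z;
  lunit : forall X, Hom smc_cat (tens tunit X) X;
  luniti : forall X, Hom smc_cat X (tens tunit X);
  lunitK : forall X, luniti X ∘ lunit X = idm _;
  lunitiK : forall X, lunit X ∘ luniti X = idm _;
  lunit_nat : forall X Y (f : Hom smc_cat X Y),
    lunit Y ∘ tensm (idm tunit) f = f ∘ lunit X;
  runit : forall X, Hom smc_cat (tens X tunit) X;
  runiti : forall X, Hom smc_cat X (tens X tunit);
  runitK : forall X, runiti X ∘ runit X = idm _;
  runitiK : forall X, runit X ∘ runiti X = idm _;
  runit_nat : forall X Y (f : Hom smc_cat X Y),
    runit Y ∘ tensm f (idm tunit) = f ∘ runit X;
  braid : forall X Y, Hom smc_cat (tens X Y) (tens Y X);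
  braidK : forall X Y, braid Y X ∘ braid X Y = idm _;
  braid_nat : forall X X' Y Y' (f : Hom smc_cat X X') (g : Hom smc_cat Y Y'),
    braid X' Y' ∘ tensm f g = tensm g f ∘ braid X Y;
  triangle : forall X Y,
    tensm (idm X) (lunit Y) ∘ assoc X tunit Y = tensm (runit X) (idm Y);
  pentagon : forall X Y Z W,
    assoc X Y (tens Z W) ∘ assoc (tens X Y) Z W
    = tensm (idm X) (assoc Y Z W) ∘ assoc X (tens Y Z) W
      ∘ tensm (assoc X Y Z) (idm W);
  hexagon : forall X Y Z,
    assoc Y Z X ∘ braid X (tens Y Z) ∘ assoc X Y Z
    = tensm (idm Y) (braid X Z) ∘ assoc Y X Z ∘ tensm (braid X Y) (idm Z)
}.
Arguments tunit {s}.
Arguments tens {s} X Y : rename.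
Arguments tensm {s X X' Y Y'} f g : rename.
Arguments assoc {s} X Y Z : rename.
Arguments associ {s} X Y Z : rename.
Arguments lunit {s} X : rename.
Arguments luniti {s} X : rename.
Arguments runit {s} X : rename.
Arguments runiti {s} X : rename.
Arguments braid {s} X Y : rename.
Notation "X ⊠ Y" := (tens X Y) (at level 35, right associativity) : cat_scope.
Notation "f ⊗ g" := (tensm f g) (at level 35, right associativity) : cat_scope.

Definition midswap (C : SymMonCat) (X Y Z W : C) :
    Hom C ((X ⊠ Y) ⊠ (Z ⊠ W)) ((X ⊠ Z) ⊠ (Y ⊠ W)) :=
  associ X Z (Y ⊠ W)
  ∘ (idm X ⊗ (assoc Z Y W ∘ (braid Y Z ⊗ idm W) ∘ associ Y Z W))
  ∘ assoc X Y (Z ⊠ W).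

Record CDCat := {
  cd_smc :> SymMonCat;
  copy : forall X : cd_smc, Hom cd_smc X (X ⊠ X);
  del : forall X : cd_smc, Hom cd_smc X tunit;
  copy_assoc : forall X,
    assoc X X X ∘ (copy X ⊗ idm X) ∘ copy X = (idm X ⊗ copy X) ∘ copy X;
  copy_unit : forall X, lunit X ∘ (del X ⊗ idm X) ∘ copy X = idm X;
  copy_comm : forall X, braid X X ∘ copy X = copy X;
  copy_tens : forall X Y, copy (X ⊠ Y) = midswap X X Y Y ∘ (copy X ⊗ copy Y);
  del_tens : forall X Y, del (X ⊠ Y) = lunit tunit ∘ (del X ⊗ del Y);
  copy_tunit : copy tunit = luniti tunit;
  del_tunit : del tunit = idm tunit
}.
Arguments copy {c} X : rename.
Arguments del {c} X : rename.

Definition total (C : CDCat) (X Y : C) (f : Hom C X Y) : Prop :=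
  del Y ∘ f = del X.
Definition copyable (C : CDCat) (X Y : C) (f : Hom C X Y) : Prop :=
  copy Y ∘ f = (f ⊗ f) ∘ copy X.
Definition deterministic (C : CDCat) (X Y : C) (f : Hom C X Y) : Prop :=
  total f /\ copyable f.

Definition copyable_class (C : CDCat) : MorClass C.
Proof.
refine (@Build_MorClass C (@copyable C) _ _).
- by move=> X; rewrite /copyable tens_id comp_idl comp_idr.
- move=> X Y Z g f cg cf; rewrite /copyable in cg cf *.
  by rewrite compA cg -compA cf compA tens_comp.
Defined.

Definition det_class (C : CDCat) : MorClass C.
Proof.
refine (@Build_MorClass C (@deterministic C) _ _).
- by move=> X; split; [exact: comp_idr | exact: (mc_id (copyable_class C))].
- move=> X Y Z g f [tg cg] [tf cf]; split; last exact: (mc_comp (m := copyable_class C)).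
  by rewrite /total compA tg tf.
Defined.

Definition Cop (C : CDCat) : Category := WideSub (copyable_class C).
Definition Det (C : CDCat) : Category := WideSub (det_class C).
Definition det_incl (C : CDCat) : Functor (Det C) C := wide_incl (det_class C).

Record MarkovCat := {
  mk_cd :> CDCat;
  mk_total : forall (X Y : mk_cd) (f : Hom mk_cd X Y), total f
}.

Definition positive (C : MarkovCat) : Prop :=
  forall (X Y Z : C) (u : Hom C X Y) (v : Hom C Y Z),
    deterministic (v ∘ u) ->
    (u ⊗ (v ∘ u)) ∘ copy X = (idm Y ⊗ v) ∘ copy Y ∘ u.

(** A witness that [C] is representable. *)
Record Representation (C : MarkovCat) := {
  rep_P : Functor C (Det C);
  rep_adj : Adjunction (det_incl C) rep_P
}.

Definition dist_monad (C : MarkovCat) (R : Representation C) : Monad (Det C) :=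
  adj_monad (rep_adj R).

Record partializable (C : MarkovCat) : Prop := {
  pz_positive : positive C;
  pz_pullback : forall (X Y B : C) (f : Hom C X Y) (j : Hom C B Y),
    deterministic j -> mono j ->
    (exists (W : C) (u : Hom C W X) (v : Hom C W B), is_pullback f j u v) /\
    (forall (W : C) (u : Hom C W X) (v : Hom C W B),
       is_pullback f j u v -> deterministic u /\ mono u);
  pz_tens_mono : forall (D X A : C) (i : Hom C D X),
    deterministic i -> mono i -> mono (i ⊗ idm A)
}.

Lemma mono_comp (C : Category) (X Y Z : C) (g : Hom C Y Z) (f : Hom C X Y) :
  mono g -> mono f -> mono (g ∘ f).
Proof. by move=> mg mf T x y; rewrite -!compA => /mg /mf. Qed.

Lemma mono_id (C : Category) (X : C) : mono (idm X).
Proof. by move=> T x y; rewrite !comp_idl. Qed.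

Lemma iso_mono (C : Category) (X Y : C) (f : Hom C X Y) (g : Hom C Y X) :
  g ∘ f = idm X -> mono f.
Proof.
by move=> gf T x y e; rewrite -(comp_idl x) -(comp_idl y) -gf -!compA e.
Qed.

Lemma pb_paste (C : Category) (X Y Z Y' V W : C) (f : Hom C X Z) (g : Hom C Y Z)
    (p : Hom C W X) (q : Hom C W Y) (h : Hom C Y' Y) (p' : Hom C V W)
    (q' : Hom C V Y') :
  is_pullback f g p q -> is_pullback q h p' q' ->
  is_pullback f (g ∘ h) (p ∘ p') q'.
Proof.
move=> [e1 u1] [e2 u2]; split; first by rewrite compA e1 -compA e2 compA.
move=> T x y e; rewrite -compA in e.
have [m [[m1 m2] um]] := u1 _ _ _ e.
have [n [[n1 n2] un]] := u2 _ _ _ m2.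
exists n; split; first by rewrite -compA n1 m1 n2.
move=> n' [n1' n2']; apply: un; split=> //.
apply/esym/um; split; first by rewrite compA.
by rewrite compA e2 -compA n2'.
Qed.

Lemma pb_sym (C : Category) (X Y Z W : C) (f : Hom C X Z) (g : Hom C Y Z)
    (p : Hom C W X) (q : Hom C W Y) :
  is_pullback f g p q -> is_pullback g f q p.
Proof.
move=> [e u]; split=> // T x y exy.
have [m [[m1 m2] um]] := u _ _ _ (esym exy).
by exists m; split=> // n [n1 n2]; apply: um.
Qed.

Section CDFacts.
Variable C : CDCat.

Lemma midswap_nat (X X' Y Y' Z Z' W W' : C) (f : Hom C X X') (g : Hom C Y Y')
    (h : Hom C Z Z') (k : Hom C W W') :
  midswap X' Y' Z' W' ∘ ((f ⊗ g) ⊗ (h ⊗ k))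
  = ((f ⊗ h) ⊗ (g ⊗ k)) ∘ midswap X Y Z W.
Proof.
have associ_nat (A A' B B' D D' : C) (a : Hom C A A') (b : Hom C B B')
    (d : Hom C D D') :
    associ A' B' D' ∘ (a ⊗ (b ⊗ d)) = ((a ⊗ b) ⊗ d) ∘ associ A B D.
  rewrite -[LHS]comp_idr -(associK A B D) !compA -(compA (associ A' B' D')).
  by rewrite -assoc_nat !compA assocK comp_idl.
have mid_nat : (assoc Z' Y' W' ∘ (braid Y' Z' ⊗ idm W') ∘ associ Y' Z' W')
      ∘ (g ⊗ (h ⊗ k))
    = (h ⊗ (g ⊗ k)) ∘ (assoc Z Y W ∘ (braid Y Z ⊗ idm W) ∘ associ Y Z W).
  rewrite -[LHS]compA associ_nat [RHS]compA [in RHS]compA -assoc_nat.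
  rewrite !compA; congr (_ ∘ _); rewrite -[LHS]compA -[RHS]compA.
  by rewrite -!tens_comp braid_nat comp_idl comp_idr.
rewrite /midswap -[LHS]compA assoc_nat [LHS]compA; rewrite [in RHS]compA.
congr (_ ∘ _); rewrite [in RHS]compA -associ_nat -[LHS]compA -[RHS]compA.
by rewrite -!tens_comp mid_nat comp_idl comp_idr.
Qed.

Lemma det_tens (X X' Y Y' : C) (f : Hom C X X') (g : Hom C Y Y') :
  deterministic f -> deterministic g -> deterministic (f ⊗ g).
Proof.
move=> [tf cf] [tg cg]; split.
  by rewrite /total !del_tens -compA -tens_comp tf tg.
rewrite /copyable !copy_tens -compA -tens_comp cf cg tens_comp.
by rewrite [LHS]compA midswap_nat -compA.
Qed.

Lemma det_cancel (X Y Z : C) (j : Hom C Y Z) (v : Hom C X Y) :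
  deterministic j -> mono (j ⊗ j) -> deterministic (j ∘ v) -> deterministic v.
Proof.
move=> [tj cj] mj [tjv cjv]; split.
  by rewrite /total -tjv compA tj.
apply: mj; rewrite [LHS]compA [RHS]compA -tens_comp.
by rewrite -[LHS](congr1 (fun w => w ∘ v) cj) -compA.
Qed.

Definition pi2 (X Y : C) : Hom C (X ⊠ Y) Y := lunit Y ∘ (del X ⊗ idm Y).
Definition pi1 (X Y : C) : Hom C (X ⊠ Y) X := pi2 Y X ∘ braid X Y.

Lemma braid_tunit : braid (@tunit C) tunit = idm _.
Proof.
rewrite -[LHS]comp_idr -(lunitK tunit) compA -copy_tunit copy_comm.
by rewrite copy_tunit lunitK.
Qed.

Lemma pi_copy (X Y : C) : (pi1 X Y ⊗ pi2 X Y) ∘ copy (X ⊠ Y) = idm _.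
Proof.
rewrite /pi1 /pi2 -(compA _ _ (braid X Y)) -braid_nat compA.
rewrite copy_tens tens_comp compA -[_ ∘ midswap _ _ _ _]compA.
rewrite -midswap_nat.
have -> : midswap X tunit tunit Y = idm _.
  by rewrite /midswap braid_tunit tens_id comp_idr associK tens_id comp_idr assocK.
rewrite comp_idl -!tens_comp copy_unit.
rewrite -(compA (lunit X)) braid_nat compA -compA copy_comm.
by rewrite copy_unit tens_id.
Qed.
End CDFacts.

Section Partial.
Variables (C : MarkovCat) (HC : partializable C).

Lemma det_id (X : C) : deterministic (idm X).
Proof. exact: (mc_id (det_class C)). Qed.

Lemma mono_tens (X X' Y Y' : C) (i : Hom C X X') (j : Hom C Y Y') :
  deterministic i -> mono i -> deterministic j -> mono j -> mono (i ⊗ j).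
Proof.
move=> di mi dj mj.
have -> : i ⊗ j = (i ⊗ idm Y') ∘ (idm X ⊗ j).
  by rewrite -tens_comp comp_idl comp_idr.
apply: mono_comp; first exact: pz_tens_mono.
have -> : idm X ⊗ j = braid Y' X ∘ ((j ⊗ idm X) ∘ braid X Y).
  by rewrite -braid_nat compA braidK comp_idl.
apply: mono_comp; first exact: (iso_mono (braidK _ _)).
by apply: mono_comp; [exact: pz_tens_mono | exact: (iso_mono (braidK _ _))].
Qed.

Lemma pi2_nat (X X' Y Y' : C) (f : Hom C X X') (g : Hom C Y Y') :
  pi2 X' Y' ∘ (f ⊗ g) = g ∘ pi2 X Y.
Proof.
rewrite /pi2 [RHS]compA -lunit_nat -[LHS]compA -[RHS]compA -!tens_comp.
by rewrite (mk_total f) !comp_idl comp_idr.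
Qed.

Lemma pi1_nat (X X' Y Y' : C) (f : Hom C X X') (g : Hom C Y Y') :
  pi1 X' Y' ∘ (f ⊗ g) = f ∘ pi1 X Y.
Proof. by rewrite /pi1 -[LHS]compA braid_nat compA pi2_nat compA. Qed.

Lemma det_pair (X Y E : C) (e : Hom C E (X ⊠ Y)) : deterministic e ->
  ((pi1 X Y ∘ e) ⊗ (pi2 X Y ∘ e)) ∘ copy E = e.
Proof.
move=> [_ ce]; rewrite tens_comp -compA -ce compA pi_copy; exact: comp_idl.
Qed.

(** To check that a square over a deterministic monomorphism [j] is a pullback
    it suffices to test it against deterministic maps. *)
Lemma pb_test (X Y B W : C) (f : Hom C X Y) (j : Hom C B Y)
    (u : Hom C W X) (v : Hom C W B) :
  deterministic j -> mono j -> mono u -> f ∘ u = j ∘ v ->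
  (forall (E : C) (e : Hom C E X) (h : Hom C E B), deterministic e ->
     f ∘ e = j ∘ h -> exists m, u ∘ m = e) ->
  is_pullback f j u v.
Proof.
move=> dj mj mu e0 fac; split=> // T x y exy.
have [[E [e [h pbE]]] /(_ _ _ _ _) detE] := pz_pullback HC f dj mj.
have [de _] := detE _ _ _ pbE.
have [m um] := fac _ _ _ de (proj1 pbE).
have [n [[n1 n2] _]] := proj2 pbE _ _ _ exy.
have em : u ∘ (m ∘ n) = x by rewrite compA um.
exists (m ∘ n); split.
  by split=> //; apply: mj; rewrite compA -e0 -compA em.
by move=> n' [n1' _]; apply: mu; rewrite em.
Qed.

Lemma pb_tens (X Y B W X' Y' B' W' : C)
    (f : Hom C X Y) (j : Hom C B Y) (u : Hom C W X) (v : Hom C W B)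
    (f' : Hom C X' Y') (j' : Hom C B' Y') (u' : Hom C W' X') (v' : Hom C W' B') :
  deterministic j -> mono j -> deterministic j' -> mono j' ->
  is_pullback f j u v -> is_pullback f' j' u' v' ->
  is_pullback (f ⊗ f') (j ⊗ j') (u ⊗ u') (v ⊗ v').
Proof.
move=> dj mj dj' mj' pb pb'.
have [_ /(_ _ _ _ pb) [du mu]] := pz_pullback HC f dj mj.
have [_ /(_ _ _ _ pb') [du' mu']] := pz_pullback HC f' dj' mj'.
apply: pb_test.
- exact: det_tens.
- exact: mono_tens.
- exact: mono_tens.
- by rewrite -!tens_comp (proj1 pb) (proj1 pb').
- move=> E e h de eh.
have e1 : f ∘ (pi1 X X' ∘ e) = j ∘ (pi1 B B' ∘ h).
  by rewrite [LHS]compA -(pi1_nat f f') -[LHS]compA eh [LHS]compA pi1_nat -[LHS]compA.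
have e2 : f' ∘ (pi2 X X' ∘ e) = j' ∘ (pi2 B B' ∘ h).
  by rewrite [LHS]compA -(pi2_nat f f') -[LHS]compA eh [LHS]compA pi2_nat -[LHS]compA.
have [k1 [[k1e _] _]] := proj2 pb _ _ _ e1.
have [k2 [[k2e _] _]] := proj2 pb' _ _ _ e2.
exists ((k1 ⊗ k2) ∘ copy E).
by rewrite compA -tens_comp k1e k2e det_pair.
Qed.

Record span (X Y : C) := Span {
  apex : C;
  leg : Hom C apex X;
  leg_det : deterministic leg;
  leg_mono : mono leg;
  mor : Hom C apex Y
}.
Arguments leg_det {X Y} s.
Arguments leg_mono {X Y} s T g h _.

Definition span_equiv (X Y : C) (s s' : span X Y) : Prop :=
  exists t : Hom C (apex s) (apex s'),
    is_iso t /\ leg s' ∘ t = leg s /\ mor s' ∘ t = mor s.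

Lemma equiv_intro (X Y : C) (s s' : span X Y) (m : Hom C (apex s) (apex s'))
    (m' : Hom C (apex s') (apex s)) :
  leg s' ∘ m = leg s -> mor s' ∘ m = mor s -> leg s ∘ m' = leg s' ->
  span_equiv s s'.
Proof.
move=> lm mm lm'; exists m; split=> //; exists m'; split.
- by apply: (leg_mono s); rewrite compA lm' lm comp_idr.
- by apply: (leg_mono s'); rewrite compA lm lm' comp_idr.
Qed.

Lemma equiv_refl (X Y : C) (s : span X Y) : span_equiv s s.
Proof. by apply: (@equiv_intro _ _ _ _ (idm _) (idm _)); rewrite comp_idr. Qed.

Lemma equiv_sym (X Y : C) (s s' : span X Y) : span_equiv s s' -> span_equiv s' s.
Proof.
move=> [t [[t' [t1 t2]] [lt mt]]].
apply: (@equiv_intro _ _ _ _ t' t) => //.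
- by rewrite -lt -compA t2 comp_idr.
- by rewrite -mt -compA t2 comp_idr.
Qed.

Lemma equiv_trans (X Y : C) (s s' s'' : span X Y) :
  span_equiv s s' -> span_equiv s' s'' -> span_equiv s s''.
Proof.
move=> e e'; have [r [_ [lr _]]] := equiv_sym e; have [r' [_ [lr' _]]] := equiv_sym e'.
move: e e' => [t [_ [lt mt]]] [t' [_ [lt' mt']]].
apply: (@equiv_intro _ _ _ _ (t' ∘ t) (r ∘ r')); rewrite compA.
- by rewrite lt'.
- by rewrite mt'.
- by rewrite lr.
Qed.

(** Morphisms of [Partial C]: equivalence classes of spans, as sets of spans. *)
Definition pmor (X Y : C) : Type :=
  {S : span X Y -> Prop | exists s, S = span_equiv s}.

Definition cls (X Y : C) (s : span X Y) : pmor X Y :=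
  exist _ (span_equiv s) (ex_intro _ s erefl).

Lemma clsP (X Y : C) (s s' : span X Y) : cls s = cls s' <-> span_equiv s s'.
Proof.
split=> [e|e].
  have /= -> := congr1 (fun F => proj1_sig F s') e; exact: equiv_refl.
apply: sub_eq => /=; apply: functional_extensionality => r.
apply: propositional_extensionality; split; apply: equiv_trans => //.
exact: equiv_sym.
Qed.

Lemma repr_ex (X Y : C) (F : pmor X Y) : exists s, cls s = F.
Proof. by case: F => S [s e]; exists s; apply: sub_eq. Qed.

Definition repr (X Y : C) (F : pmor X Y) : span X Y :=
  proj1_sig (constructive_indefinite_description _ (repr_ex F)).

Lemma cls_repr (X Y : C) (F : pmor X Y) : cls (repr F) = F.
Proof. exact: (proj2_sig (constructive_indefinite_description _ (repr_ex F))). Qed.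

(** [s] is the composite of [s1] followed by [s2], for some choice of pullback. *)
Definition is_comp (X Y Z : C) (s1 : span X Y) (s2 : span Y Z) (s : span X Z) : Prop :=
  exists (u : Hom C (apex s) (apex s1)) (v : Hom C (apex s) (apex s2)),
    is_pullback (mor s1) (leg s2) u v /\
    leg s = leg s1 ∘ u /\ mor s = mor s2 ∘ v.

Lemma is_comp_ex (X Y Z : C) (s1 : span X Y) (s2 : span Y Z) :
  exists s, is_comp s1 s2 s.
Proof.
have [[W [u [v pb]]] dm] := pz_pullback HC (mor s1) (leg_det s2) (leg_mono s2).
have [du mu] := dm _ _ _ pb.
have dl : deterministic (leg s1 ∘ u).
  exact: (mc_comp (m := det_class C) (leg_det s1) du).
exists (Span dl (mono_comp (leg_mono s1) mu) (mor s2 ∘ v)).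
by exists u, v.
Qed.

Lemma is_comp_uniq (X Y Z : C) (s1 s1' : span X Y) (s2 s2' : span Y Z)
    (s s' : span X Z) :
  span_equiv s1 s1' -> span_equiv s2 s2' ->
  is_comp s1 s2 s -> is_comp s1' s2' s' -> span_equiv s s'.
Proof.
have aux (r1 r1' : span X Y) (r2 r2' : span Y Z) (r r' : span X Z) :
    span_equiv r1 r1' -> span_equiv r2 r2' ->
    is_comp r1 r2 r -> is_comp r1' r2' r' ->
    exists m, leg r' ∘ m = leg r /\ mor r' ∘ m = mor r.
  move=> [t1 [_ [lt1 mt1]]] [t2 [_ [lt2 mt2]]].
  move=> [u [v [[e _] [lr mr]]]] [u' [v' [[_ pb'] [lr' mr']]]].
  have e' : mor r1' ∘ (t1 ∘ u) = leg r2' ∘ (t2 ∘ v).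
    by rewrite !compA mt1 lt2.
  have [m [[m1 m2] _]] := pb' _ _ _ e'.
  exists m; rewrite lr lr' mr mr' -!compA m1 m2 !compA.
  by rewrite lt1 mt2.
move=> e1 e2 c c'; have [m [lm mm]] := aux _ _ _ _ _ _ e1 e2 c c'.
have [m' [lm' _]] := aux _ _ _ _ _ _ (equiv_sym e1) (equiv_sym e2) c' c.
exact: equiv_intro lm mm lm'.
Qed.

(** Composition of classes: [pcompE] shows that it does not depend on the
    choice of representatives and of a pullback. *)
Definition pcomp (X Y Z : C) (G : pmor Y Z) (F : pmor X Y) : pmor X Z :=
  cls (proj1_sig (constructive_indefinite_description _
    (is_comp_ex (repr F) (repr G)))).

Lemma pcompE (X Y Z : C) (s1 : span X Y) (s2 : span Y Z) (s : span X Z) :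
  is_comp s1 s2 s -> pcomp (cls s2) (cls s1) = cls s.
Proof.
move=> c; rewrite /pcomp.
set r := constructive_indefinite_description _ _; case: r => r /= cr.
by apply/clsP; apply: is_comp_uniq cr c; apply/clsP; exact: cls_repr.
Qed.

Definition incl (X Y : C) (f : Hom C X Y) : pmor X Y :=
  cls (Span (det_id X) (@mono_id _ X) f).

Lemma pcomp_incl_l (X Y Z : C) (s : span X Y) (g : Hom C Y Z) :
  pcomp (incl g) (cls s)
  = cls (Span (leg_det s) (leg_mono s) (g ∘ mor s)).
Proof.
apply: pcompE; exists (idm _), (mor s) => /=; split; last by rewrite comp_idr.
split; first by rewrite comp_idl comp_idr.
move=> T x y; rewrite comp_idl => exy.
by exists x; split; [rewrite comp_idl | move=> m []; rewrite comp_idl].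
Qed.

Lemma pcomp_incl_pb (X X' Y' : C) (s' : span X' Y') (phi : Hom C X X')
    (D : C) (d : Hom C D X) (dd : deterministic d) (md : mono d)
    (t : Hom C D (apex s')) :
  is_pullback phi (leg s') d t ->
  pcomp (cls s') (incl phi) = cls (Span dd md (mor s' ∘ t)).
Proof. by move=> pb; apply: pcompE; exists d, t; rewrite /= comp_idl. Qed.

Lemma incl_nat (X X' Y Y' : C) (s : span X Y) (s' : span X' Y')
    (phi : Hom C X X') (theta : Hom C Y Y') (t : Hom C (apex s) (apex s')) :
  is_pullback phi (leg s') (leg s) t -> mor s' ∘ t = theta ∘ mor s ->
  pcomp (incl theta) (cls s) = pcomp (cls s') (incl phi).
Proof.
move=> pb e; rewrite pcomp_incl_l.
by rewrite (pcomp_incl_pb (leg_det s) (leg_mono s) pb) e.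
Qed.

Lemma iso_pb (X X' D D' : C) (phi : Hom C X X') (psi : Hom C X' X)
    (d : Hom C D X) (d' : Hom C D' X') (t : Hom C D D') (t' : Hom C D' D) :
  psi ∘ phi = idm X -> mono d -> t ∘ t' = idm D' ->
  phi ∘ d = d' ∘ t -> is_pullback phi d' d t.
Proof.
move=> phiK md tK e; split=> // T x y exy.
have dx : d ∘ (t' ∘ y) = x.
  rewrite -[LHS]comp_idl -phiK -compA (compA phi) e.
  by rewrite -(compA d') (compA t) tK comp_idl -exy compA phiK comp_idl.
exists (t' ∘ y); split; first by split=> //; rewrite compA tK comp_idl.
by move=> m [m1 _]; apply: md; rewrite dx.
Qed.

Lemma pcomp_idl (X Y : C) (F : pmor X Y) : pcomp (incl (idm Y)) F = F.
Proof.
rewrite -(cls_repr F) pcomp_incl_l comp_idl; congr cls.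
by case: (repr F).
Qed.

Lemma pcomp_idr (X Y : C) (F : pmor X Y) : pcomp F (incl (idm X)) = F.
Proof.
rewrite -[in LHS](cls_repr F) -[RHS]pcomp_idl -[in RHS](cls_repr F).
apply/esym/(@incl_nat _ _ _ _ _ _ _ _ (idm _)); last by rewrite comp_idl comp_idr.
apply: (@iso_pb _ _ _ _ _ (idm X) _ _ _ (idm _)); rewrite ?comp_idl ?comp_idr //.
exact: leg_mono.
Qed.

Lemma pcompA (X Y Z W : C) (H : pmor Z W) (G : pmor Y Z) (F : pmor X Y) :
  pcomp H (pcomp G F) = pcomp (pcomp H G) F.
Proof.
rewrite -(cls_repr F) -(cls_repr G) -(cls_repr H).
set s1 := repr F; set s2 := repr G; set s3 := repr H.
have [s12 c12] := is_comp_ex s1 s2; have [s23 c23] := is_comp_ex s2 s3.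
rewrite (pcompE c12) (pcompE c23).
move: c12 c23 => [u [v [pb [l12 m12]]]] [p [q [pb' [l23 m23]]]].
have [_ dm] := pz_pullback HC (mor s2) (leg_det s3) (leg_mono s3).
have [dp mp] := dm _ _ _ pb'.
have [[V [x [y pb'']]] dm'] := pz_pullback HC v dp mp.
have [dx mx] := dm' _ _ _ pb''.
have dl : deterministic (leg s12 ∘ x).
  exact: (mc_comp (m := det_class C) (leg_det s12) dx).
pose s := Span dl (mono_comp (leg_mono s12) mx) (mor s3 ∘ (q ∘ y)).
have -> : pcomp (cls s3) (cls s12) = cls s.
  apply: pcompE; exists x, (q ∘ y); split=> //=; rewrite m12.
  apply: pb_sym; apply: pb_paste; first exact: (pb_sym pb').
  exact: (pb_sym pb'').
apply/esym/pcompE; exists (u ∘ x), y; split; last first.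
  by rewrite /= l12 m23 !compA.
by rewrite l23; apply: pb_paste pb pb''.
Qed.

Definition PartialCat : Category :=
  @Build_Category C pmor (fun X => incl (idm X)) pcomp pcomp_idl pcomp_idr pcompA.

Definition tens_span (X X' Y Y' : C) (s : span X X') (s' : span Y Y') :
    span (X ⊠ Y) (X' ⊠ Y') :=
  Span (det_tens (leg_det s) (leg_det s'))
    (mono_tens (leg_det s) (leg_mono s)
               (leg_det s') (leg_mono s'))
    (mor s ⊗ mor s').

Definition ptens (X X' Y Y' : C) (F : pmor X X') (G : pmor Y Y') :
    pmor (X ⊠ Y) (X' ⊠ Y') :=
  cls (tens_span (repr F) (repr G)).

Lemma ptensE (X X' Y Y' : C) (s : span X X') (s' : span Y Y') :
  ptens (cls s) (cls s') = cls (tens_span s s').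
Proof.
have e : span_equiv (repr (cls s)) s by apply/clsP/cls_repr.
have e' : span_equiv (repr (cls s')) s' by apply/clsP/cls_repr.
have [r [_ [lr _]]] := equiv_sym e; have [r' [_ [lr' _]]] := equiv_sym e'.
move: e e' => [t [_ [lt mt]]] [t' [_ [lt' mt']]].
apply/clsP; apply: (@equiv_intro _ _ (tens_span _ _) (tens_span _ _) (t ⊗ t') (r ⊗ r')) => /=;
  rewrite -tens_comp.
- by rewrite lt lt'.
- by rewrite mt mt'.
- by rewrite lr lr'.
Qed.

Lemma cls_ext (X Y D : C) (d d' : Hom C D X) (dd : deterministic d)
    (dd' : deterministic d') (md : mono d) (md' : mono d') (f f' : Hom C D Y) :
  d = d' -> f = f' -> cls (Span dd md f) = cls (Span dd' md' f').
Proof.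
move=> e e'; subst d' f'.
by rewrite (proof_irrelevance _ dd dd') (proof_irrelevance _ md md').
Qed.

Lemma incl_tens (X X' Y Y' : C) (f : Hom C X X') (g : Hom C Y Y') :
  ptens (incl f) (incl g) = incl (f ⊗ g).
Proof. by rewrite ptensE; apply: cls_ext => //; exact: tens_id. Qed.

Lemma incl_comp (X Y Z : C) (g : Hom C Y Z) (f : Hom C X Y) :
  pcomp (incl g) (incl f) = incl (g ∘ f).
Proof. by rewrite pcomp_incl_l; apply: cls_ext. Qed.

Lemma ptens_comp (X X' X'' Y Y' Y'' : C) (F' : pmor X' X'') (F : pmor X X')
    (G' : pmor Y' Y'') (G : pmor Y Y') :
  ptens (pcomp F' F) (pcomp G' G) = pcomp (ptens F' G') (ptens F G).
Proof.
rewrite -(cls_repr F) -(cls_repr F') -(cls_repr G) -(cls_repr G').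
have [s c] := is_comp_ex (repr F) (repr F').
have [r k] := is_comp_ex (repr G) (repr G').
rewrite (pcompE c) (pcompE k) !ptensE; apply/esym/pcompE.
move: c k => [u [v [pb [l m]]]] [u' [v' [pb' [l' m']]]].
exists (u ⊗ u'), (v ⊗ v'); rewrite /= l l' m m' -!tens_comp; split=> //.
by apply: pb_tens => //; [exact: leg_det | exact: leg_mono
  | exact: leg_det | exact: leg_mono].
Qed.

Lemma incl_nat_iso (X X' Y Y' : C) (s : span X Y) (s' : span X' Y')
    (phi : Hom C X X') (psi : Hom C X' X) (theta : Hom C Y Y')
    (t : Hom C (apex s) (apex s')) (t' : Hom C (apex s') (apex s)) :
  psi ∘ phi = idm X -> t ∘ t' = idm _ ->
  phi ∘ leg s = leg s' ∘ t -> theta ∘ mor s = mor s' ∘ t ->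
  pcomp (incl theta) (cls s) = pcomp (cls s') (incl phi).
Proof.
move=> phiK tK e e'; apply: incl_nat (esym e').
exact: iso_pb phiK (leg_mono s) tK e.
Qed.

Definition PartialSMC : SymMonCat.
Proof.
refine (@Build_SymMonCat PartialCat (@tunit C) (@tens C) ptens _ ptens_comp
  (fun X Y Z => incl (assoc X Y Z)) (fun X Y Z => incl (associ X Y Z)) _ _ _
  (fun X => incl (lunit X)) (fun X => incl (luniti X)) _ _ _
  (fun X => incl (runit X)) (fun X => incl (runiti X)) _ _ _
  (fun X Y => incl (braid X Y)) _ _ _ _ _) => /=.
- by move=> X Y; rewrite incl_tens tens_id.
- by move=> X Y Z; rewrite incl_comp assocK.
- by move=> X Y Z; rewrite incl_comp associK.
- move=> X X' Y Y' Z Z' F G H.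
  rewrite -(cls_repr F) -(cls_repr G) -(cls_repr H) !ptensE.
  by apply: (@incl_nat_iso _ _ _ _ (tens_span (tens_span _ _) _)
    (tens_span _ (tens_span _ _)) _ _ _ _ _ (assocK _ _ _) (associK _ _ _)) => /=; exact: assoc_nat.
- by move=> X; rewrite incl_comp lunitK.
- by move=> X; rewrite incl_comp lunitiK.
- move=> X Y F; rewrite -(cls_repr F) ptensE.
  by apply: (@incl_nat_iso _ _ _ _
    (tens_span (Span (det_id _) (@mono_id _ tunit) (idm _)) (repr F)) (repr F) _ _ _ _ _
    (lunitK _) (lunitiK _)) => /=; exact: lunit_nat.
- by move=> X; rewrite incl_comp runitK.
- by move=> X; rewrite incl_comp runitiK.
- move=> X Y F; rewrite -(cls_repr F) ptensE.
  by apply: (@incl_nat_iso _ _ _ _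
    (tens_span (repr F) (Span (det_id _) (@mono_id _ tunit) (idm _))) (repr F) _ _ _ _ _
    (runitK _) (runitiK _)) => /=; exact: runit_nat.
- by move=> X Y; rewrite incl_comp braidK.
- move=> X X' Y Y' F G; rewrite -(cls_repr F) -(cls_repr G) !ptensE.
  by apply: (@incl_nat_iso _ _ _ _ (tens_span _ _) (tens_span _ _) _ _ _ _ _
    (braidK _ _) (braidK _ _)) => /=; exact: braid_nat.
- by move=> X Y; rewrite !incl_tens incl_comp triangle.
- by move=> X Y Z W; rewrite !(incl_tens, incl_comp) pentagon.
- by move=> X Y Z; rewrite !(incl_tens, incl_comp) hexagon.
Defined.

Definition Partial : CDCat.
Proof.
refine (@Build_CDCat PartialSMC (fun X => incl (copy (c := C) X))
  (fun X => incl (del (c := C) X)) _ _ _ _ _ _ _) => /=.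
- by move=> X; rewrite !(incl_tens, incl_comp) copy_assoc.
- by move=> X; rewrite !(incl_tens, incl_comp) copy_unit.
- by move=> X; rewrite !(incl_tens, incl_comp) copy_comm.
- by move=> X Y; rewrite /midswap /= !(incl_tens, incl_comp) copy_tens.
- by move=> X Y; rewrite !(incl_tens, incl_comp) del_tens.
- by rewrite copy_tunit.
- by rewrite del_tunit.
Defined.

Lemma ptens_copy (X Y : C) (s : span X Y) :
  pcomp (ptens (cls s) (cls s)) (incl (copy X))
  = cls (Span (leg_det s) (leg_mono s) ((mor s ⊗ mor s) ∘ copy (apex s))).
Proof.
rewrite ptensE.
have [_ cl] := leg_det s.
rewrite (@pcomp_incl_pb _ _ _ (tens_span s s) _ _ _ (leg_det s)
  (leg_mono s) (copy (apex s))) //.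
apply: pb_test => /=.
- by apply: det_tens; exact: leg_det.
- by apply: mono_tens; try exact: leg_det; exact: leg_mono.
- exact: leg_mono.
- exact: cl.
- move=> E e h _ eh; exists (pi2 _ _ ∘ h).
  rewrite compA -(pi2_nat (leg s)) -compA -eh compA.
  suff -> : pi2 X X ∘ copy X = idm X by rewrite comp_idl.
  exact: copy_unit.
Qed.

Lemma copyable_clsP (X Y : C) (s : span X Y) :
  copyable (C := Partial) (cls s) <-> deterministic (mor s).
Proof.
rewrite /copyable /= ptens_copy pcomp_incl_l; split=> [/clsP|[_ ->] //].
move=> [t [_ /= [lt mt]]]; split; first exact: mk_total.
have t1 : t = idm _ by apply: (leg_mono s); rewrite lt comp_idr.
by move: mt; rewrite t1 comp_idr.
Qed.

(** The morphism of [Partial C]_cop represented by a span in [C]_det. *)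
Definition cop_span (X Y D : C) (d : Hom (Det C) D X)
    (md : mono (C := C) (proj1_sig d)) (f : Hom (Det C) D Y) :
    Hom (Cop Partial) X Y :=
  exist _ (cls (Span (proj2_sig d) md (proj1_sig f)))
    (proj2 (copyable_clsP (Span (proj2_sig d) md (proj1_sig f))) (proj2_sig f)).

Definition cop_incl (X Y : C) (f : Hom (Det C) X Y) : Hom (Cop Partial) X Y :=
  exist _ (incl (proj1_sig f))
    (proj2 (copyable_clsP (Span (det_id X) (@mono_id _ X) (proj1_sig f))) (proj2_sig f)).

Variable R : Representation C.

Definition Pob (X : C) : C := rep_P R X.
Definition Pm (X Y : C) (f : Hom C X Y) : Hom C (Pob X) (Pob Y) :=
  proj1_sig (fmap (rep_P R) f).
Definition samp (X : C) : Hom C (Pob X) X := adj_counit (rep_adj R) X.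
Definition delta (X : C) : Hom C X (Pob X) := proj1_sig (adj_unit (rep_adj R) X).

Lemma Pm_det (X Y : C) (f : Hom C X Y) : deterministic (Pm f).
Proof. exact: proj2_sig. Qed.

Lemma Pm_id (X : C) : Pm (idm X) = idm (Pob X).
Proof. by rewrite /Pm fmap_id. Qed.

Lemma Pm_comp (X Y Z : C) (g : Hom C Y Z) (f : Hom C X Y) :
  Pm (g ∘ f) = Pm g ∘ Pm f.
Proof. by rewrite /Pm fmap_comp. Qed.

Lemma samp_nat (X Y : C) (f : Hom C X Y) : samp Y ∘ Pm f = f ∘ samp X.
Proof. exact: (nt_natural (adj_counit (rep_adj R)) f). Qed.

Lemma delta_det (X : C) : deterministic (delta X).
Proof. exact: proj2_sig. Qed.

Lemma delta_nat (X Y : C) (f : Hom C X Y) : deterministic f ->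
  delta Y ∘ f = Pm f ∘ delta X.
Proof.
move=> df.
exact: (congr1 (@proj1_sig _ _)
  (nt_natural (adj_unit (rep_adj R)) (exist _ f df : Hom (Det C) X Y))).
Qed.

Lemma samp_delta (X : C) : samp X ∘ delta X = idm X.
Proof. exact: (adj_triangle_l (rep_adj R) X). Qed.

Lemma Psamp_delta (X : C) : Pm (samp X) ∘ delta (Pob X) = idm (Pob X).
Proof. exact: (congr1 (@proj1_sig _ _) (adj_triangle_r (rep_adj R) X)). Qed.

Lemma transpose_ex (T X : C) (f : Hom C T X) :
  exists g, deterministic g /\ samp X ∘ g = f.
Proof.
exists (Pm f ∘ delta T); split.
  by apply: (mc_comp (m := det_class C)); [exact: Pm_det | exact: delta_det].
by rewrite compA samp_nat -compA samp_delta comp_idr.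
Qed.

Lemma transpose_uniq (T X : C) (g h : Hom C T (Pob X)) :
  deterministic g -> deterministic h -> samp X ∘ g = samp X ∘ h -> g = h.
Proof.
have aux (k : Hom C T (Pob X)) : deterministic k -> k = Pm (samp X ∘ k) ∘ delta T.
  by move=> dk; rewrite Pm_comp -compA -delta_nat // compA Psamp_delta comp_idl.
by move=> /aux {2}-> /aux {2}-> ->.
Qed.

(** Naturality squares of [samp] at deterministic monomorphisms are pullbacks. *)
Lemma samp_pb (D X : C) (d : Hom C D X) : deterministic d -> mono d ->
  mono (Pm d) /\ is_pullback (samp X) d (Pm d) (samp D).
Proof.
move=> dd md.
have [[E [e [f pb]]] dm] := pz_pullback HC (samp X) dd md.
have [de me] := dm _ _ _ pb.
have [g [dg sg]] := transpose_ex f.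
have eg : Pm d ∘ g = e.
  apply: transpose_uniq => //.
    by apply: (mc_comp (m := det_class C)) => //; exact: Pm_det.
  by rewrite compA samp_nat -compA sg (proj1 pb).
have [k [[k1 k2] _]] := proj2 pb _ _ _ (samp_nat d).
have dk : deterministic k.
  apply: (det_cancel (j := e)) => //; first exact: mono_tens.
  by rewrite k1; exact: Pm_det.
have gk : g ∘ k = idm _.
  apply: transpose_uniq; first exact: (mc_comp (m := det_class C)).
    exact: det_id.
  by rewrite compA sg k2 comp_idr.
have mPd : mono (Pm d) by rewrite -k1; apply: mono_comp => //; exact: iso_mono gk.
split=> //; apply: pb_test => //; first exact: samp_nat.
move=> A a h da ah; have [m [[m1 _] _]] := proj2 pb _ _ _ ah.
by exists (g ∘ m); rewrite compA eg.
Qed.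

Lemma Pm_mono (D X : C) (d : Hom C D X) :
  deterministic d -> mono d -> mono (Pm d).
Proof. by move=> dd md; have [] := samp_pb dd md. Qed.

Lemma Pm_pb (X Y B W : C) (f : Hom C X Y) (j : Hom C B Y)
    (u : Hom C W X) (v : Hom C W B) :
  deterministic j -> mono j -> is_pullback f j u v ->
  is_pullback (Pm f) (Pm j) (Pm u) (Pm v).
Proof.
move=> dj mj pb.
have [_ /(_ _ _ _ pb) [du mu]] := pz_pullback HC f dj mj.
apply: pb_test.
- exact: Pm_det.
- exact: Pm_mono.
- exact: Pm_mono.
- by rewrite -!Pm_comp (proj1 pb).
- move=> E e h de eh.
have eh' : f ∘ (samp X ∘ e) = j ∘ (samp B ∘ h).
  by rewrite [LHS]compA -samp_nat -compA eh compA samp_nat -compA.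
have [m [[m1 _] _]] := proj2 pb _ _ _ eh'.
have [g [dg sg]] := transpose_ex m.
exists g; apply: transpose_uniq => //.
  by apply: (mc_comp (m := det_class C)) => //; exact: Pm_det.
by rewrite compA samp_nat -compA sg.
Qed.

Lemma delta_pb (D X : C) (d : Hom C D X) : deterministic d -> mono d ->
  is_pullback (delta X) (Pm d) d (delta D).
Proof.
move=> dd md; apply: pb_test => //.
- exact: Pm_det.
- exact: Pm_mono.
- exact: delta_nat.
- move=> E e h _ eh; exists (samp D ∘ h).
by rewrite compA -samp_nat -compA -eh compA samp_delta comp_idl.
Qed.

Lemma mult_pb (D X : C) (d : Hom C D X) : deterministic d -> mono d ->
  is_pullback (Pm (samp X)) (Pm d) (Pm (Pm d)) (Pm (samp D)).
Proof.
by move=> dd md; apply: Pm_pb => //; have [] := samp_pb dd md.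
Qed.

Definition P_span (X Y : C) (s : span X Y) : span (Pob X) (Pob Y) :=
  Span (Pm_det (leg s)) (Pm_mono (leg_det s) (leg_mono s))
    (Pm (mor s)).

Definition P_pmor (X Y : C) (F : pmor X Y) : pmor (Pob X) (Pob Y) :=
  cls (P_span (repr F)).

Lemma P_pmorE (X Y : C) (s : span X Y) : P_pmor (cls s) = cls (P_span s).
Proof.
have e : span_equiv (repr (cls s)) s by apply/clsP/cls_repr.
have [r [_ [lr _]]] := equiv_sym e; move: e => [t [_ [lt mt]]].
apply/clsP; apply: (@equiv_intro _ _ (P_span _) (P_span _) (Pm t) (Pm r)) => /=;
  by rewrite -Pm_comp ?lt ?mt ?lr.
Qed.

Lemma P_pmor_cop (X Y : C) (F : pmor X Y) : copyable (C := Partial) (P_pmor F).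
Proof. by apply/copyable_clsP; exact: Pm_det. Qed.

Lemma P_pmor_incl (X Y : C) (f : Hom C X Y) : P_pmor (incl f) = incl (Pm f).
Proof. by rewrite P_pmorE; apply: cls_ext => //; exact: Pm_id. Qed.

Definition partial_P : Functor (Cop Partial) (Cop Partial).
Proof.
refine (@Build_Functor (Cop Partial) (Cop Partial) Pob
  (fun X Y F => exist _ (P_pmor (proj1_sig F)) (P_pmor_cop (proj1_sig F))) _ _).
- by move=> X; apply: sub_eq; rewrite /= P_pmor_incl Pm_id.
- move=> X Y Z G F; apply: sub_eq => /=; case: G F => [G _] [F _] /=.
  rewrite -(cls_repr F) -(cls_repr G).
  have [s c] := is_comp_ex (repr F) (repr G).
  rewrite (pcompE c) !P_pmorE; apply/esym/pcompE.
  move: c => [u [v [pb [l m]]]]; exists (Pm u), (Pm v).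
  rewrite /= l m !Pm_comp; split=> //.
  by apply: Pm_pb => //; [exact: leg_det | exact: leg_mono].
Defined.

Definition partial_delta : NatTrans (id_functor (Cop Partial)) partial_P.
Proof.
refine (@Build_NatTrans (Cop Partial) (Cop Partial) (id_functor _) partial_P
  (fun X => cop_incl (mnd_unit (dist_monad R) X)) _).
move=> X Y F; apply: sub_eq; case: F => [F cF] /=.
move: cF; rewrite -(cls_repr F) P_pmorE; set s := repr F => /copyable_clsP ds.
apply: (@incl_nat _ _ _ _ s (P_span s) _ _ (delta (apex s))) => /=.
  by apply: delta_pb; [exact: leg_det | exact: leg_mono].
exact/esym/delta_nat.
Defined.

Definition partial_mu : NatTrans (comp_functor partial_P partial_P) partial_P.
Proof.
refine (@Build_NatTrans (Cop Partial) (Cop Partial)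
  (comp_functor partial_P partial_P) partial_P
  (fun X => cop_incl (mnd_mult (dist_monad R) X)) _).
move=> X Y F; apply: sub_eq; case: F => [F _] /=.
rewrite -(cls_repr F) !P_pmorE; set s := repr F.
apply: (@incl_nat _ _ _ _ (P_span (P_span s)) (P_span s) _ _ (Pm (samp (apex s)))) => /=.
  by apply: mult_pb; [exact: leg_det | exact: leg_mono].
by rewrite -[LHS]Pm_comp -samp_nat Pm_comp.
Defined.

(** The functor sends the class of [(D, d, f)] to that of [(PD, Pd, Pf)]
    (see [P_pmorE]); unit and multiplication are the images of those of
    [dist_monad R]. *)
Definition partial_dist_monad : Monad (Cop Partial).
Proof.
refine (@Build_Monad (Cop Partial) partial_P partial_delta partial_mu _ _ _) => X;
  apply: sub_eq => /=; rewrite ?P_pmor_incl !incl_comp.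
- exact: (congr1 (fun f => incl (proj1_sig f)) (mnd_unit_l (dist_monad R) X)).
- exact: (congr1 (fun f => incl (proj1_sig f)) (mnd_unit_r (dist_monad R) X)).
- exact: (congr1 (fun f => incl (proj1_sig f)) (mnd_assoc (dist_monad R) X)).
Defined.

End Partial.

(* Main.v *)
From Corelib Require Import ssreflect ssrfun.
Require Import Defs.

(** An equation between partial morphisms says that two spans are isomorphic.
    When one side is a composite, the isomorphism can be absorbed into the
    pullback that computes it, because a pullback may be replaced by any
    isomorphic one; so a span represents a composite exactly when it _is_ a
    composite for a suitable choice of pullback ([pcompP]).  The two algebra
    laws are read off from this.

    - Unit law: the identity span is a composite of [delta] and [(D, d, a)].
      A pullback of [delta] and [d] whose first leg is an identity is nothing
      but a factorization [s] of [delta] through [d], and the law for the second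
      leg says [a ∘ s = idm A].
    - Multiplication law: some span is a composite of [(PD, Pd, Pa)] with
      [(D, d, a)] and also of [mu] with [(D, d, a)].  Its apex is [D']; since the
      first leg of the image of [mu] is an identity, the leg of this span is at
      once [Pd ∘ t] and the projection of the pullback of [mu] and [d].

    It remains to pass between pullbacks in [C], which define composition of
    partial morphisms, and pullbacks in [Det C].  The two notions agree over a
    deterministic monomorphism of [C] ([pb_DetP]), because a map is
    deterministic as soon as its composite with a deterministic monomorphism is
    ([det_lift]). *)

Set Implicit Arguments.
Unset Strict Implicit.
Unset Printing Implicit Defensive.

(** Replaces a pullback by an isomorphic one.  The maps [m] and [n] are mutually inverse,
    since the universal property forces [m ∘ n = idm W]. *)
Lemma pb_retract (C : Category) (X Y Z W V : C) (f : Hom C X Z) (g : Hom C Y Z)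
    (p : Hom C W X) (q : Hom C W Y) (p' : Hom C V X) (q' : Hom C V Y)
    (m : Hom C V W) (n : Hom C W V) :
  is_pullback f g p q -> n ∘ m = idm V -> p ∘ m = p' -> q ∘ m = q' ->
  p' ∘ n = p -> q' ∘ n = q -> is_pullback f g p' q'.
Proof.
move=> [e u] nm pm qm pn qn; split; first by rewrite -pm -qm !compA e.
move=> T x y /u [k [[k1 k2] uk]]; exists (n ∘ k); split.
  by rewrite !compA pn qn.
move=> k' [k1' k2'].
by rewrite (uk (m ∘ k')) ?compA ?nm ?comp_idl // pm qm.
Qed.

Lemma pb_mono (C : Category) (X Y Z : C) (f : Hom C X Z) (g : Hom C Y Z)
    (v : Hom C X Y) :
  mono g -> g ∘ v = f -> is_pullback f g (idm X) v.
Proof.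
move=> mg e; split; first by rewrite e comp_idr.
move=> T x y exy; exists x; split; last by move=> m []; rewrite comp_idl.
by rewrite comp_idl; split=> //; apply: mg; rewrite compA e.
Qed.

Section Partializable.
Variables (C : MarkovCat) (HC : partializable C).

(** Copyability is tested after the monomorphism [j ⊗ j]. *)
Lemma det_lift (X Y Z : C) (j : Hom C Y Z) (v : Hom C X Y) :
  deterministic j -> mono j -> deterministic (j ∘ v) -> deterministic v.
Proof. by move=> dj mj; apply: det_cancel => //; exact: mono_tens. Qed.

(** The substance is that the pullback taken in [C] already lies in [Det C] and
    is universal there; uniqueness of pullbacks in [Det C] then gives the
    converse. *)
Lemma pb_DetP (X Y B W : C) (f : Hom (Det C) X Y) (j : Hom (Det C) B Y)
    (u : Hom (Det C) W X) (v : Hom (Det C) W B) :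
  mono (C := C) (proj1_sig j) ->
  is_pullback (C := Det C) f j u v <->
  is_pullback (C := C) (proj1_sig f) (proj1_sig j) (proj1_sig u) (proj1_sig v).
Proof.
move=> mj; have dj := proj2_sig j.
have [[W0 [u0 [v0 pb0]]] dm] := pz_pullback HC (proj1_sig f) dj mj.
split=> [[e un]|pb].
- have e' := congr1 (@proj1_sig _ _) e; rewrite /= in e'.
  have [du0 mu0] := dm _ _ _ pb0.
  have dv0 : deterministic v0.
    apply: (det_lift dj mj); rewrite -(proj1 pb0).
    by apply: (mc_comp (m := det_class C)) => //; exact: proj2_sig.
  have [m [[m1 m2] _]] := proj2 pb0 _ _ _ e'.
  have dmm : deterministic m by apply: (det_lift du0 mu0); rewrite m1; exact: proj2_sig.
  pose U0 : Hom (Det C) W0 X := exist _ u0 du0.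
  pose V0 : Hom (Det C) W0 B := exist _ v0 dv0.
  pose M : Hom (Det C) W W0 := exist _ m dmm.
  have e0 : f ∘ U0 = j ∘ V0 by apply: sub_eq; exact: proj1 pb0.
  have [n [[n1 n2] _]] := un _ _ _ e0.
  have [k [_ uk]] := un _ _ _ e.
  have nM : n ∘ M = idm _.
    rewrite -(uk (idm _)) ?comp_idr //; apply/esym/uk.
    by rewrite !compA n1 n2; split; apply: sub_eq.
  apply: (pb_retract pb0 (congr1 (@proj1_sig _ _) nM) m1 m2).
    exact: (congr1 (@proj1_sig _ _) n1).
  exact: (congr1 (@proj1_sig _ _) n2).
- have [_ mu] := dm _ _ _ pb.
  split; first by apply: sub_eq; exact: proj1 pb.
  move=> T x y e; have [m [[m1 m2] um]] := proj2 pb _ _ _ (congr1 (@proj1_sig _ _) e).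
  have dmm : deterministic m.
    by apply: (det_lift (proj2_sig u) mu); rewrite m1; exact: proj2_sig.
  exists (exist _ m dmm); split; first by split; apply: sub_eq.
  move=> m' [m1' m2']; apply: sub_eq; apply: um; split.
    exact: (congr1 (@proj1_sig _ _) m1').
  exact: (congr1 (@proj1_sig _ _) m2').
Qed.

(** From left to right, the isomorphism of apices supplied by [clsP] is absorbed
    into the pullback. *)
Lemma pcompP (X Y Z : C) (s1 : span X Y) (s2 : span Y Z) (s : span X Z) :
  pcomp HC (cls s2) (cls s1) = cls s <-> is_comp s1 s2 s.
Proof.
split; last exact: pcompE.
have [r cr] := is_comp_ex HC s1 s2; rewrite (pcompE HC cr) => /clsP.
move: cr => [u [v [pb [l m]]]] [t [[t' [t't tt']] [lt mt]]].
exists (u ∘ t'), (v ∘ t'); split; last first.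
  by rewrite !compA -l -m -lt -mt -!compA tt' !comp_idr.
by apply: (pb_retract (m := t') (n := t) pb); rewrite -?compA ?t't ?comp_idr.
Qed.

End Partializable.

Section Algebra.
Variables (C : MarkovCat) (HC : partializable C) (R : Representation C).
Variables (A D : C) (d : Hom (Det C) D (dist_monad R A)) (a : Hom (Det C) D A).
Hypothesis md : mono (C := C) (proj1_sig d).

Let M := partial_dist_monad HC R.
Let alpha : Hom (Cop (Partial HC)) (M A) A := cop_span HC md a.
Let T := dist_monad R.

Lemma unit_lawP :
  alpha ∘ mnd_unit M A = idm (C := Cop (Partial HC)) A <->
  exists s : Hom (Det C) A D,
    unique (fun s' : Hom (Det C) A D => d ∘ s' = mnd_unit T A) s
    /\ a ∘ s = idm (C := Det C) A.
Proof.
split=> [/(congr1 (@proj1_sig _ _)) /pcompP|].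
- move=> [u [v [[e _] /= [l m]]]].
  (* both first legs are identities, so the pullback projection [u] is one *)
  have u1 : u = idm A by rewrite -[LHS]comp_idl -l.
  have {}e : proj1_sig d ∘ v = delta R A by rewrite -e u1; exact: comp_idr.
  have dv : deterministic v.
    by apply: (det_lift HC (proj2_sig d) md); rewrite e; exact: delta_det.
  exists (exist _ v dv); split; last exact: sub_eq.
  split; first exact: sub_eq.
  move=> s' /(congr1 (@proj1_sig _ _)) es'.
  by apply: sub_eq; apply: md; rewrite e; exact: esym.
- move=> [s [[es _] as1]]; apply: sub_eq; apply/pcompP.
  exists (idm _), (proj1_sig s) => /=; split.
    by apply: pb_mono => //; exact: (congr1 (@proj1_sig _ _) es).
  by split; [rewrite comp_idl | rewrite -[LHS](congr1 (@proj1_sig _ _) as1)].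
Qed.

Lemma mult_lawP :
  alpha ∘ fmap M alpha = alpha ∘ mnd_mult M A <->
  exists (D' : C) (t : Hom (Det C) D' (T D))
    (b : Hom (Det C) D' D) (c : Hom (Det C) D' D),
    is_pullback (C := Det C) (fmap T a) d t b
    /\ is_pullback (C := Det C) (mnd_mult T A) d (fmap T d ∘ t) c
    /\ a ∘ b = a ∘ c.
Proof.
split=> [/(congr1 (@proj1_sig _ _)) /=|].
- rewrite P_pmorE; set s1 := P_span _ _ _.
  set s2 := Span _ _ _ => e.
  have [s cs] := is_comp_ex HC s1 s2.
  have /pcompP := esym (etrans (esym (pcompE HC cs)) e).
  move: cs => [t [b [pb1 /= [l m]]]] [u' [c [pb2 /= [l' m']]]].
  (* the first leg of the image of [mu] is an identity, so the projection [u'] is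
     itself the leg of the composite span *)
  have eu' : u' = Pm R (proj1_sig d) ∘ t by rewrite -l l' comp_idl.
  subst u'.
  have [dt mt] := proj2 (pz_pullback HC (mor s1) (proj2_sig d) md) _ _ _ pb1.
  have db : deterministic b.
    apply: (det_lift HC (proj2_sig d) md); rewrite -[X in deterministic X](proj1 pb1).
    by apply: (mc_comp (m := det_class C)) => //; exact: Pm_det.
  have dc : deterministic c.
    apply: (det_lift HC (proj2_sig d) md); rewrite -[X in deterministic X](proj1 pb2).
    apply: (mc_comp (m := det_class C)); first exact: Pm_det.
    by apply: (mc_comp (m := det_class C)) => //; exact: Pm_det.
  exists (apex s), (exist _ t dt), (exist _ b db), (exist _ c dc).
  split; first by apply/pb_DetP.
  split; first by apply/pb_DetP.
  by apply: sub_eq; rewrite /= -m -m'.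
- move=> [D' [t [b [c [/(pb_DetP HC) pb1 [/(pb_DetP HC) pb2 abc]]]]]].
  have {}pb1 := pb1 md; have {}pb2 := pb2 md.
  have [_ ml] := proj2 (pz_pullback HC _ (proj2_sig d) md) _ _ _ pb2.
  apply: sub_eq; rewrite /= P_pmorE.
  set s2 := Span _ _ _; set s1 := P_span _ _ _.
  pose s : span (Pob R (Pob R A)) A :=
    Span (proj2_sig (fmap T d ∘ t)) ml (proj1_sig (a ∘ b)).
  transitivity (cls s).
    by apply/pcompP; exists (proj1_sig t), (proj1_sig b).
  apply/esym/pcompP; exists (proj1_sig (fmap T d ∘ t)), (proj1_sig c).
  split; first exact: pb2.
  by split; [rewrite comp_idl | exact: (congr1 (@proj1_sig _ _) abc)].
Qed.

End Algebra.

Theorem proposition4p7 (C : MarkovCat) (HC : partializable C)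
    (R : Representation C) (A : C) :
  let T : Monad (Det C) := dist_monad R in
  let M : Monad (Cop (Partial HC)) := partial_dist_monad HC R in
  (forall alpha : Hom (Cop (Partial HC)) (M A) A,
     exists (D : C) (d : Hom (Det C) D (T A)) (a : Hom (Det C) D A)
       (md : mono (C := C) (proj1_sig d)), alpha = cop_span HC md a)
  /\
  (forall (D : C) (d : Hom (Det C) D (T A)) (a : Hom (Det C) D A)
       (md : mono (C := C) (proj1_sig d)),
     is_algebra (M := M) (A := A) (cop_span HC md a)
     <->
     (exists s : Hom (Det C) A D,
        unique (fun s' : Hom (Det C) A D => d ∘ s' = mnd_unit T A) s
        /\ a ∘ s = idm (C := Det C) A)
     /\
     (exists (D' : C) (t : Hom (Det C) D' (T D))
        (b : Hom (Det C) D' D) (c : Hom (Det C) D' D),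
        is_pullback (C := Det C) (fmap T a) d t b
        /\ is_pullback (C := Det C) (mnd_mult T A) d (fmap T d ∘ t) c
        /\ a ∘ b = a ∘ c)).
Proof.
move=> T M; split=> [[F cF]|D d a md].
- have eF := cls_repr F; set s := repr F in eF.
  have da : deterministic (mor s) by apply/(copyable_clsP HC); rewrite eF.
  exists (apex s), (exist _ (leg s) (leg_det s)), (exist _ (mor s) da), (@leg_mono _ _ _ s).
  by apply: sub_eq; rewrite /= -eF; case: (s).
- by rewrite /is_algebra unit_lawP mult_lawP.
Qed.
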